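(* Let $\mathcal{H}$ be a complex Hilbert space and let $T=\begin{bmatrix} T_{11} & T_{12}\\ T_{21} & T_{22}\end{bmatrix}\in\mathcal{B}(\mathcal{H}\oplus\mathcal{H})$ have Cartesian decomposition $$T=\begin{bmatrix} A_{11} & A_{12}\\ A_{12}^* & A_{22}\end{bmatrix}+\mathrm{i}\begin{bmatrix} B_{11} & B_{12}\\ B_{12}^* & B_{22}\end{bmatrix},$$ where all blocks belong to $\mathcal{B}(\mathcal{H})$. Then $$\begin{aligned}\left\|\begin{bmatrix} T_{11} & T_{12}\\ T_{21} & T_{22}\end{bmatrix}\right\|&\le\frac12\left(\|A_{11}\|+\|A_{22}\|+\sqrt{(\|A_{11}\|-\|A_{22}\|)^2+4\|A_{12}\|^2}\right)\\&\quad+\frac12\left(\|B_{11}\|+\|B_{22}\|+\sqrt{(\|B_{11}\|-\|B_{22}\|)^2+4\|B_{12}\|^2}\right).\end{aligned}$$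
   Context: $\mathcal{B}(\mathcal{K})$ denotes the algebra of bounded linear operators on a complex Hilbert space $\mathcal{K}$, and $\|\cdot\|$ is the operator norm. The real and imaginary parts of $S\in\mathcal{B}(\mathcal{K})$ are $\mathcal{R}S=\frac{S+S^*}{2}$ and $\mathcal{I}S=\frac{S-S^*}{2\mathrm{i}}$, both self-adjoint, and the Cartesian decomposition of $S$ is $S=\mathcal{R}S+\mathrm{i}\,\mathcal{I}S$; thus in the claim $\begin{bmatrix} A_{11} & A_{12}\\ A_{12}^* & A_{22}\end{bmatrix}=\mathcal{R}T$ and $\begin{bmatrix} B_{11} & B_{12}\\ B_{12}^* & B_{22}\end{bmatrix}=\mathcal{I}T$. *)

(* Defs.v *)
From HB Require Import structures.
From mathcomp Require Import all_boot all_order all_algebra.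
From mathcomp Require Import sesquilinear complex.
From mathcomp Require Import boolp classical_sets functions reals.
From mathcomp Require Import interval_inference topology normedtype.
From mathcomp Require Import ring lra.

Set Implicit Arguments.
Unset Strict Implicit.
Unset Printing Implicit Defensive.

Import Order.TTheory GRing.Theory Num.Def Num.Theory.
Import numFieldNormedType.Exports.

Local Open Scope classical_set_scope.
Local Open Scope complex_scope.
Local Open Scope ring_scope.

Section DotTheory.
Variables (C : numClosedFieldType) (U : lmodType C) (form : {dot U for conjC}).

Local Notation "''[' u , v ]" := (form u%R v%R) : ring_scope.
Local Notation "''[' u ]" := '[u, u]%R : ring_scope.

Lemma dotC u v : '[u, v] = ('[v, u]^*)%R.
Proof. by rewrite (hermC form u v) expr0 mul1r. Qed.

Lemma dnorm_proj u v : v != 0 ->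
  '[u - ('[u, v] / '[v]) *: v] = '[u] - `|'[u, v]| ^+ 2 / '[v].
Proof.
rewrite -(dnorm_eq0 form) => v0; set t := _ / _; set s := _ / _.
have vr : ('[v]^*)%R = '[v] by rewrite -dotC.
have sE : (t^*)%R * '[u, v] = s.
  by rewrite /s /t normCK rmorphM /= fmorphV /= vr mulrAC [_^*%R * _]mulrC.
have sr : (s^*)%R = s by rewrite /s normCK !rmorphM /= fmorphV /= conjCK vr [_^*%R * _]mulrC.
have tE : `|t| ^+ 2 * '[v] = s by rewrite -sE normCK [t * _]mulrC -mulrA /t divfK.
rewrite dnormB dnormZ linearZr_LR /= sE sr tE -addrA; congr (_ + _).
by rewrite opprD addrA subrr sub0r.
Qed.

Lemma dot_CauchySchwarz u v : `|'[u, v]| ^+ 2 <= '[u] * '[v].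
Proof.
have [->|v0] := eqVneq v 0; first by rewrite !linear0r normr0 expr0n mulr0.
have vgt0 : 0 < '[v] by rewrite dnorm_gt0.
rewrite -ler_pdivrMr // -subr_ge0 -dnorm_proj //.
Qed.

Lemma dot_CauchySchwarz_sqrt u v : `|'[u, v]| <= sqrtC '[u] * sqrtC '[v].
Proof.
rewrite -(@ler_pXn2r _ 2) ?nnegrE ?mulr_ge0 ?sqrt_dnorm_ge0 //.
by rewrite exprMn !sqrtCK dot_CauchySchwarz.
Qed.

Lemma dnormD_le u v : sqrtC '[u + v] <= sqrtC '[u] + sqrtC '[v].
Proof.
rewrite -(@ler_pXn2r _ 2) ?nnegrE ?addr_ge0 ?sqrt_dnorm_ge0 //.
rewrite sqrrD !sqrtCK dnormD addrAC lerD2r lerD2l /= addrC.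
apply: le_trans (_ : `|'[u, v]| *+ 2 <= _); last first.
  by rewrite lerMn2r dot_CauchySchwarz_sqrt.
rewrite addrC -dotC.
have r : '[u, v] + '[v, u] \is Num.real.
  by rewrite CrealE rmorphD /= -!dotC addrC.
apply: le_trans (real_ler_norm r) _; apply: le_trans (ler_normD _ _) _.
by rewrite [in X in _ + X]dotC norm_conjC.
Qed.

Lemma dnorm_parallelogram u v : '[u + v] + '[u - v] = ('[u] + '[v]) *+ 2.
Proof. by rewrite dnormD dnormB addrACA subrr addr0 -mulr2n. Qed.

End DotTheory.

(* The inner product is linear in its first argument and conjugate-linear in
   the second one. *)
HB.mixin Record isHilbert (R : realType) H & CompleteNormedModule R[i] H := {
  dotp : {dot H for @conjC R[i]} ;
  normrE_dotp : forall x : H, `|x| ^+ 2 = dotp x x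
}.

#[short(type="hilbertType")]
HB.structure Definition Hilbert (R : realType) :=
  {H of CompleteNormedModule R[i] H & isHilbert R H}.

(* The product type of two normed modules already carries the sup norm in the
   library, so the Hilbert direct sum is an alias of it. *)
Definition dsum (U V : Type) : Type := (U * V)%type.

HB.instance Definition _ (R : realType) (U V : hilbertType R) :=
  GRing.Lmodule.copy (dsum U V) (U * V)%type.

Section DsumDot.
Variables (R : realType) (U V : hilbertType R).
Implicit Types x y z : dsum U V.

Definition dsum_dot x y : R[i] := dotp x.1 y.1 + dotp x.2 y.2.

Lemma dsum_dot_bilinear : bilinear_for
  (GRing.Scale.Law.clone _ _ *%R _) (GRing.Scale.Law.clone _ _ (@conjC R[i] \; *%R) _)
  dsum_dot.
Proof.
split=> [z|z] a x y; rewrite /dsum_dot /=.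
  by rewrite !linearPl /= mulrDr addrACA.
by rewrite !linearPr /= mulrDr addrACA.
Qed.

HB.instance Definition _ := bilinear_isBilinear.Build R[i] (dsum U V) (dsum U V)
  R[i] _ _ dsum_dot dsum_dot_bilinear.

Lemma dsum_dot_herm x y : dsum_dot x y = (-1) ^+ false * (dsum_dot y x)^*%R.
Proof.
by rewrite expr0 mul1r /dsum_dot rmorphD /= -!dotC.
Qed.

HB.instance Definition _ := isHermitianSesquilinear.Build R[i] (dsum U V) false
  (@conjC R[i]) dsum_dot dsum_dot_herm.

Lemma dsum_dot_gt0 x : x != 0 -> 0 < dsum_dot x x.
Proof.
move=> x0; rewrite lt_neqAle addr_ge0 ?dnorm_ge0 // andbT eq_sym.
rewrite paddr_eq0 ?dnorm_ge0 // !dnorm_eq0; apply: contra x0.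
by case: x => x1 x2 /= /andP[/eqP -> /eqP ->].
Qed.

HB.instance Definition _ := isDotProduct.Build R[i] (dsum U V) dsum_dot dsum_dot_gt0.

Definition dsum_form : {dot (dsum U V) for @conjC R[i]} := dsum_dot.

Definition dsum_norm x : R[i] := sqrtC (dsum_form x x).

End DsumDot.
Section DsumNormed.
Variables (R : realType) (U V : hilbertType R).
Implicit Types x y z : dsum U V.

Lemma dsum_normD x y : dsum_norm (x + y) <= dsum_norm x + dsum_norm y.
Proof. exact: dnormD_le. Qed.

Lemma dsum_normZ (a : R[i]) x : dsum_norm (a *: x) = `|a| * dsum_norm x.
Proof.
by rewrite /dsum_norm dnormZ sqrtCM ?nnegrE ?exprn_ge0 // sqrCK.
Qed.

Lemma dsum_norm0_eq0 x : dsum_norm x = 0 -> x = 0.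
Proof. by move=> /eqP; rewrite sqrt_dnorm_eq0 => /eqP. Qed.

HB.instance Definition _ := Lmodule_isNormed.Build R[i] (dsum U V)
  dsum_normD dsum_normZ dsum_norm0_eq0.

Lemma dsum_norm_sqr x : `|x| ^+ 2 = `|x.1| ^+ 2 + `|x.2| ^+ 2.
Proof.
by rewrite -[`|x|]/(dsum_norm x) sqrtCK !normrE_dotp.
Qed.

Lemma dsum_norm_fst x : `|x.1| <= `|x|.
Proof.
by rewrite -(@ler_pXn2r _ 2) ?nnegrE // dsum_norm_sqr lerDl exprn_ge0.
Qed.

Lemma dsum_norm_snd x : `|x.2| <= `|x|.
Proof.
by rewrite -(@ler_pXn2r _ 2) ?nnegrE // dsum_norm_sqr lerDr exprn_ge0.
Qed.

Lemma dsum_norm_le x : `|x| <= `|x.1| + `|x.2|.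
Proof.
rewrite -(@ler_pXn2r _ 2) ?nnegrE ?addr_ge0 // dsum_norm_sqr sqrrD.
by rewrite addrAC lerDl mulrn_wge0 ?mulr_ge0.
Qed.

Lemma dsum_complete (F : set_system (dsum U V)) :
  ProperFilter F -> cauchy F -> cvg F.
Proof.
move=> FF /cauchy_ballP Fc.
have cv (W : completeNormedModType R[i]) (p : dsum U V -> W) :
    (forall x y, `|p x - p y| <= `|x - y|) -> exists l : W, p @ F --> l.
  move=> ple; exists (lim (p @ F)); apply: cauchy_cvg; apply/cauchy_ballP => e e0.
  rewrite near_map2; apply: filterS (Fc e e0) => -[x y] /=.
  by rewrite -!ball_normE /=; exact: le_lt_trans.
have [l1 Fl1] := cv U fst (fun x y => dsum_norm_fst (x - y)).
have [l2 Fl2] := cv V snd (fun x y => dsum_norm_snd (x - y)).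
apply/cvg_ex; exists ((l1, l2) : dsum U V).
apply/cvgrPdist_lt => e e0; near=> x.
apply: le_lt_trans (dsum_norm_le _) _ => /=; rewrite [e]splitr ltrD //.
  by near: x; have /cvgrPdist_lt := Fl1; apply; rewrite divr_gt0.
by near: x; have /cvgrPdist_lt := Fl2; apply; rewrite divr_gt0.
Unshelve. all: by end_near. Qed.

HB.instance Definition _ := Uniform_isComplete.Build (dsum U V) dsum_complete.

Lemma dsum_normE x : `|x| ^+ 2 = dsum_form U V x x.
Proof. by rewrite -[`|x|]/(dsum_norm x) sqrtCK. Qed.

HB.instance Definition _ := isHilbert.Build R (dsum U V) dsum_normE.

End DsumNormed.
Section HilbertNorm.
Variables (R : realType) (H : hilbertType R).
Implicit Types x y : H.

(* The library norm of a vector takes its values in the nonnegative reals of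
   R[i]; hnorm is the same number in R. *)
Definition hnorm x : R := complex.Re `|x|.

Lemma hnormE x : `|x| = (hnorm x)%:C.
Proof. by rewrite /hnorm RRe_real ?normr_real. Qed.

Lemma hnorm_ge0 x : 0 <= hnorm x.
Proof. by rewrite -ler0c -hnormE. Qed.

Lemma hnorm_le x y : (hnorm x <= hnorm y) = (`|x| <= `|y|).
Proof. by rewrite !hnormE lecR. Qed.

Lemma hnorm0 : hnorm 0 = 0.
Proof. by rewrite /hnorm normr0. Qed.

Lemma hnormD x y : hnorm (x + y) <= hnorm x + hnorm y.
Proof. by rewrite -lecR rmorphD /= -!hnormE ler_normD. Qed.

Lemma hnorm_parallelogram x y :
  hnorm (x + y) ^+ 2 + hnorm (x - y) ^+ 2 = (hnorm x ^+ 2 + hnorm y ^+ 2) *+ 2.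
Proof.
apply: (@complexI R); rewrite rmorphMn !rmorphD !rmorphXn /= -!hnormE.
by rewrite !normrE_dotp dnorm_parallelogram.
Qed.

Lemma dotp_le x y : `|dotp x y| <= `|x| * `|y|.
Proof.
rewrite -(@ler_pXn2r _ 2) ?nnegrE ?mulr_ge0 // exprMn !normrE_dotp.
exact: dot_CauchySchwarz.
Qed.

End HilbertNorm.

Section Riesz.
Variables (R : realType) (H : hilbertType R) (phi : H -> R[i]).
Hypothesis phi_lin : forall a x y, phi (a *: x + y) = a * phi x + phi y.
Variable M : R.
Hypothesis phi_bnd : forall x, `|phi x| <= M%:C * `|x|.

Let phi0 : phi 0 = 0.
Proof.
have := phi_lin 1 0 0; rewrite scale1r mul1r addr0 => /eqP.
by rewrite -subr_eq subrr => /eqP.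
Qed.

Let phiZ a x : phi (a *: x) = a * phi x.
Proof. by rewrite -[a *: x]addr0 phi_lin phi0 addr0. Qed.

Let phiD x y : phi (x + y) = phi x + phi y.
Proof. by rewrite -[x in LHS]scale1r phi_lin mul1r. Qed.

Let phiB x y : phi (x - y) = phi x - phi y.
Proof. by rewrite addrC -scaleN1r phi_lin mulN1r addrC. Qed.

Lemma riesz_min : (exists x, phi x != 0) ->
  exists2 l, phi l = 1 & forall x, phi x = 1 -> hnorm l <= hnorm x.
Proof.
case=> x0 px0.
pose S := [set x | phi x = 1]; pose D := [set hnorm x | x in S].
have Dinf : has_inf D.
  split; last by exists 0 => _ [x _ <-]; exact: hnorm_ge0.
  by exists (hnorm ((phi x0)^-1 *: x0)), ((phi x0)^-1 *: x0) => //=;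
    rewrite /S /= phiZ mulVf.
pose d := inf D.
have d_ge0 : 0 <= d.
  by apply: lb_le_inf; [case: Dinf | move=> _ [x _ <-]; exact: hnorm_ge0].
have d_le x : phi x = 1 -> d <= hnorm x.
  by move=> px; apply: ge_inf; [case: Dinf | exists x].
pose A e := [set x | phi x = 1 /\ hnorm x < d + e].
have A0 e : 0 < e -> A e !=set0.
  by move=> e0; have [_ [x px <-] xd] := inf_adherent e0 Dinf; exists x.
pose F := filter_from [set e : R | 0 < e] A.
have FF : ProperFilter F.
  apply: filter_from_proper => //; apply: filter_from_filter; first by exists 1 => /=.
  move=> i j /= i0 j0; exists (Num.min i j); first by rewrite /= lt_min i0.
  move=> x [px xd]; split; split=> //; apply: lt_le_trans xd _.
    by rewrite lerD2l ge_min lexx.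
  by rewrite lerD2l ge_min lexx orbT.
have diam e x y : A e x -> A e y -> hnorm (x - y) ^+ 2 <= 4 * e * (2 * d + e).
  move=> [px xd] [py yd].
  have dxy : 2 * d <= hnorm (x + y).
    have /d_le : phi (2^-1 *: (x + y)) = 1.
      by rewrite phiZ phiD px py -(natrD _ 1 1) mulVf ?pnatr_eq0.
    rewrite -lecR -hnormE normrZ hnormE.
    have -> : `|2^-1 : R[i]| = (2^-1)%:C by rewrite ger0_norm ?invr_ge0 // fmorphV rmorph_nat.
    by rewrite -rmorphM lecR mulrC ler_pdivlMr // mulrC.
  have := hnorm_parallelogram x y => /(canRL (addKr _)) ->.
  have h0 := hnorm_ge0 x; have h1 := hnorm_ge0 y.
  rewrite mulr2n; nra.
have Fc : cauchy F.
  apply/cauchy_exP => eps eps0.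
  have [r r0 ->] : exists2 r : R, 0 < r & eps = r%:C.
    exists (complex.Re eps); last by rewrite RRe_real // gtr0_real.
    by rewrite -ltcR RRe_real // gtr0_real.
  pose e := Num.min 1 (r ^+ 2 / (8 * (2 * d + 1))).
  have e0 : 0 < e by rewrite lt_min ltr01 divr_gt0 ?exprn_gt0 //; lra.
  have e1 : e <= 1 by rewrite ge_min lexx.
  have er : 8 * (2 * d + 1) * e <= r ^+ 2.
    rewrite mulrC -ler_pdivlMr; last by lra.
    by rewrite ge_min lexx orbT.
  have [x Ax] := A0 _ e0; exists x; exists e => // y Ay.
  rewrite -ball_normE /= hnormE ltcR.
  rewrite -(@ltr_pXn2r _ 2) ?nnegrE ?hnorm_ge0 ?ltW //.
  apply: le_lt_trans (diam _ _ _ Ax Ay) _.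
  have : 0 < r ^+ 2 by rewrite exprn_gt0.
  nra.
have Fl : F --> lim F by exact: cauchy_cvg.
set l := lim F in Fl.
have near_l e : 0 < e -> exists2 x, A e x & hnorm (l - x) < e.
  move=> e0; have FA : F (A e) by exists e.
  have Fd : F [set x | `|l - x| < e%:C].
    by have /fcvgrPdist_lt := Fl; apply; rewrite ltcR.
  have [x [Ax xl]] := filter_ex (filterI FA Fd).
  by exists x => //; rewrite -ltcR -hnormE.
exists l.
  apply/eqP; rewrite -subr_eq0 -normr_eq0 -[_ == 0]negbK; apply/negP => p0.
  pose r := complex.Re `|phi l - 1|.
  have rE : `|phi l - 1| = r%:C by rewrite RRe_real ?normr_real.
  have r0 : 0 < r by rewrite -ltcR -rE lt_neqAle eq_sym p0 normr_ge0.
  have M1 : 0 < `|M| + 1 by rewrite ltr_wpDl.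
  have [x [px _] xl] := near_l _ (divr_gt0 r0 M1).
  have : r <= M * hnorm (l - x).
    by rewrite -lecR -rE -px -phiB rmorphM /= -hnormE.
  apply/negP; rewrite -ltNge.
  apply: le_lt_trans (_ : (`|M| * hnorm (l - x)) < r).
    by rewrite ler_wpM2r ?hnorm_ge0 ?ler_norm.
  move: xl; rewrite ltr_pdivlMr // => xl.
  apply: le_lt_trans xl; rewrite mulrDr mulr1 mulrC lerDl hnorm_ge0 //.
move=> x /d_le; apply: le_trans; apply/ler_addgt0Pr => e e0.
have [y [py yd] yl] := near_l _ (divr_gt0 e0 (ltr0Sn R 1)).
rewrite -[l](subrK y); apply: le_trans (hnormD _ _) _.
lra.
Qed.

Lemma riesz : exists z, forall x, phi x = dotp x z.
Proof.
have [phiN0|phi_eq0] := pselect (exists x, phi x != 0); last first.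
  exists 0 => x; rewrite linear0r; apply/eqP; apply: contra_notT phi_eq0.
  by exists x.
have [l pl lmin] := riesz_min phiN0.
have l0 : dotp l l != 0.
  rewrite dnorm_eq0; apply: contra_eq_neq pl => ->.
  by rewrite phi0 eq_sym oner_neq0.
have orth v : phi v = 0 -> dotp l v = 0.
  move=> pv; have [->|v0] := eqVneq v 0; first by rewrite linear0r.
  pose t := dotp l v / dotp v v.
  have : hnorm l <= hnorm (l - t *: v).
    by apply: lmin; rewrite phiB phiZ pv mulr0 subr0.
  rewrite hnorm_le -(@ler_pXn2r _ 2) ?nnegrE // !normrE_dotp dnorm_proj //.
  rewrite lerDl oppr_ge0 pmulr_lle0 ?invr_gt0 ?dnorm_gt0 // => h.
  apply/eqP; rewrite -normr_eq0 -sqrf_eq0 eq_le h exprn_ge0 //.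
exists (((dotp l l)^-1)^*%R *: l) => x.
rewrite linearZr_LR /= conjCK.
have : dotp l (x - phi x *: l) = 0.
  by apply: orth; rewrite phiB phiZ pl mulr1 subrr.
move=> /(congr1 (@conjC R[i])); rewrite -dotC rmorph0 linearBl linearZl_LR /=.
by move=> /eqP; rewrite subr_eq0 => /eqP ->; rewrite mulrC mulfK.
Qed.

End Riesz.
Record bop (R : realType) (H K : hilbertType R) := Bop {
  bop_fun :> H -> K ;
  bop_linear : linear bop_fun ;
  bop_bounded : exists M : R, forall x, `|bop_fun x| <= M%:C * `|x|
}.

HB.instance Definition _ (R : realType) (H K : hilbertType R) (S : bop H K) :=
  GRing.isLinear.Build R[i] H K *:%R (bop_fun S) (bop_linear S).

HB.instance Definition _ (R : realType) (H K : hilbertType R) :=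
  gen_eqMixin (bop H K).
HB.instance Definition _ (R : realType) (H K : hilbertType R) :=
  gen_choiceMixin (bop H K).

Section BopLmodule.
Variables (R : realType) (H K : hilbertType R).
Implicit Types S T : bop H K.

Lemma bop_ext S T : S =1 T -> S = T.
Proof.
case: S T => [f fl fb] [g gl gb] /= /funext fg; case: _ / fg gl gb => gl gb.
by congr Bop; exact: Prop_irrelevance.
Qed.

Lemma bop_bound S : exists2 M : R, 0 <= M & forall x, `|S x| <= M%:C * `|x|.
Proof.
have [M SM] := bop_bounded S; exists `|M| => // x.
by apply: le_trans (SM x) _; rewrite ler_wpM2r // lecR ler_norm.
Qed.

Lemma zero_linear : linear (fun _ : H => 0 : K).
Proof. by move=> a x y; rewrite scaler0 addr0. Qed.

Lemma zero_bounded : exists M : R, forall x : H, `|0 : K| <= M%:C * `|x|.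
Proof. by exists 0 => x; rewrite normr0 mul0r. Qed.

Definition bop_zero := Bop zero_linear zero_bounded.

Lemma opp_linear S : linear (fun x => - S x).
Proof. by move=> a x y; rewrite linearP opprD scalerN. Qed.

Lemma opp_bounded S : exists M : R, forall x, `|- S x| <= M%:C * `|x|.
Proof. by have [M SM] := bop_bounded S; exists M => x; rewrite normrN. Qed.

Definition bop_opp S := Bop (opp_linear S) (opp_bounded S).

Lemma add_linear S T : linear (fun x => S x + T x).
Proof. by move=> a x y; rewrite !linearP scalerDr addrACA. Qed.

Lemma add_bounded S T : exists M : R, forall x, `|S x + T x| <= M%:C * `|x|.
Proof.
have [M SM] := bop_bounded S; have [N TN] := bop_bounded T.
exists (M + N) => x; apply: le_trans (ler_normD _ _) _.
by rewrite rmorphD mulrDl lerD.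
Qed.

Definition bop_add S T := Bop (add_linear S T) (add_bounded S T).

Lemma scale_linear (a : R[i]) S : linear (fun x => a *: S x).
Proof. by move=> b x y; rewrite linearP scalerDr !scalerA mulrC. Qed.

Lemma scale_bounded (a : R[i]) S :
  exists M : R, forall x, `|a *: S x| <= M%:C * `|x|.
Proof.
have [M SM] := bop_bounded S; pose r := complex.Re `|a|.
have aE : `|a| = r%:C by rewrite RRe_real ?normr_real.
exists (r * M) => x.
by rewrite normrZ rmorphM /= -aE -mulrA ler_wpM2l.
Qed.

Definition bop_scale (a : R[i]) S := Bop (scale_linear a S) (scale_bounded a S).

Lemma bop_addA : associative bop_add.
Proof. by move=> S T W; apply: bop_ext => x /=; rewrite addrA. Qed.

Lemma bop_addC : commutative bop_add.
Proof. by move=> S T; apply: bop_ext => x /=; rewrite addrC. Qed.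

Lemma bop_add0 : left_id bop_zero bop_add.
Proof. by move=> S; apply: bop_ext => x /=; rewrite add0r. Qed.

Lemma bop_addN : left_inverse bop_zero bop_opp bop_add.
Proof. by move=> S; apply: bop_ext => x /=; rewrite addNr. Qed.

HB.instance Definition _ :=
  GRing.isZmodule.Build (bop H K) bop_addA bop_addC bop_add0 bop_addN.

Lemma bop_scaleA (a b : R[i]) S :
  bop_scale a (bop_scale b S) = bop_scale (a * b) S.
Proof. by apply: bop_ext => x /=; rewrite scalerA. Qed.

Lemma bop_scale1 : left_id 1 bop_scale.
Proof. by move=> S; apply: bop_ext => x /=; rewrite scale1r. Qed.

Lemma bop_scaleDr : right_distributive bop_scale +%R.
Proof. by move=> a S T; apply: bop_ext => x /=; rewrite scalerDr. Qed.

Lemma bop_scaleDl S : {morph bop_scale^~ S : a b / a + b}.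
Proof. by move=> a b; apply: bop_ext => x /=; rewrite scalerDl. Qed.

HB.instance Definition _ := GRing.Zmodule_isLmodule.Build R[i] (bop H K)
  bop_scaleA bop_scale1 bop_scaleDr bop_scaleDl.

Lemma bop_addE S T x : (S + T) x = S x + T x. Proof. by []. Qed.

Lemma bop_oppE S x : (- S) x = - S x. Proof. by []. Qed.

Lemma bop_scaleE (a : R[i]) S x : (a *: S) x = a *: S x. Proof. by []. Qed.

(* For H = {0} the set below is {0}, so the norm is 0 as it should be. *)
Definition opnorm S : R := sup [set hnorm (S x) | x in [set x | hnorm x <= 1]].

Lemma adj_exists S (y : K) : exists z : H, forall x, dotp (S x) y = dotp x z.
Proof.
have [M SM] := bop_bounded S.
apply: (@riesz _ _ _ _ (M * hnorm y)) => [a x x'|x].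
  by rewrite linearP linearPl.
apply: le_trans (dotp_le _ _) _.
by rewrite rmorphM /= -hnormE mulrAC ler_wpM2r.
Qed.

(* The adjoint maps y to the Riesz representative of x |-> <S x, y>; it is
   characterized by adjP below. *)
Definition adj_fun S (y : K) : H := projT1 (cid (adj_exists S y)).

Lemma adj_funP S x y : dotp (S x) y = dotp x (adj_fun S y).
Proof. by rewrite /adj_fun; case: cid => z /= ->. Qed.

End BopLmodule.

Lemma dotp_inj (R : realType) (H : hilbertType R) (y z : H) :
  (forall x, dotp x y = dotp x z) -> y = z.
Proof.
move=> yz; apply/eqP; rewrite -subr_eq0 -(dnorm_eq0 dotp).
by rewrite [dotp _ _]linearBr /= yz subrr.
Qed.

Section Adjoint.
Variables (R : realType) (H K : hilbertType R) (S : bop H K).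

Lemma adj_linear : linear (adj_fun S).
Proof.
move=> a y z; apply: dotp_inj => x.
by rewrite -adj_funP !linearPr /= !adj_funP.
Qed.

Lemma adj_bounded : exists M : R, forall y, `|adj_fun S y| <= M%:C * `|y|.
Proof.
have [M M0 SM] := bop_bound S; exists M => y.
have [->|z0] := eqVneq (adj_fun S y) 0.
  by rewrite normr0 mulr_ge0 // ler0c.
rewrite -(ler_pM2l (_ : 0 < `|adj_fun S y|)) ?normr_gt0 //.
rewrite -expr2 normrE_dotp -adj_funP.
have -> : dotp (S (adj_fun S y)) y = `|dotp (S (adj_fun S y)) y|.
  by rewrite adj_funP ger0_norm.
apply: le_trans (dotp_le _ _) _.
by rewrite mulrA ler_wpM2r // mulrC.
Qed.

Definition adj : bop K H := Bop adj_linear adj_bounded.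

Lemma adjP x y : dotp (S x) y = dotp x (adj y).
Proof. exact: adj_funP. Qed.

End Adjoint.

Section CartesianParts.
Variables (R : realType) (H : hilbertType R).
Implicit Types S : bop H H.

(* In ring_scope, 'i is the imaginary unit Num.imaginary of R[i]. *)
Definition Re_op S : bop H H := (2 : R[i])^-1 *: (S + adj S).
Definition Im_op S : bop H H := (2 * 'i : R[i])^-1 *: (S - adj S).

Lemma cartesian_decomposition S : S = Re_op S + ('i : R[i]) *: Im_op S.
Proof.
have gen (C : numClosedFieldType) (V : lmodType C) (s t : V) :
    s = 2^-1 *: (s + t) + 'i *: ((2 * 'i)^-1 *: (s - t)).
  rewrite scalerA invfM mulrCA mulfV ?neq0Ci // mulr1 -scalerDr.
  rewrite addrACA subrr addr0 -mulr2n -(scaler_nat 2 s) scalerA mulVf ?scale1r //.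
exact: (gen R[i] (bop H H) S (adj S)).
Qed.

End CartesianParts.

Section Block.
Variables (R : realType) (H1 H2 K1 K2 : hilbertType R).
Variables (S11 : bop H1 K1) (S12 : bop H2 K1) (S21 : bop H1 K2) (S22 : bop H2 K2).

Definition block_fun (x : dsum H1 H2) : dsum K1 K2 :=
  (S11 x.1 + S12 x.2, S21 x.1 + S22 x.2).

Lemma block_linear : linear block_fun.
Proof.
move=> a x y; rewrite /block_fun /= !linearP.
by rewrite [in LHS]addrACA [X in (_, X)]addrACA -!scalerDr.
Qed.

Lemma block_bounded : exists M : R, forall x, `|block_fun x| <= M%:C * `|x|.
Proof.
have [M11 p11 b11] := bop_bound S11; have [M12 p12 b12] := bop_bound S12.
have [M21 p21 b21] := bop_bound S21; have [M22 p22 b22] := bop_bound S22.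
exists ((M11 + M12) + (M21 + M22)) => x.
have le1 (L : hilbertType R) (A : bop H1 L) M : 0 <= M ->
    (forall y, `|A y| <= M%:C * `|y|) -> `|A x.1| <= M%:C * `|x|.
  by move=> M0 /(_ x.1) h; apply: le_trans h _; rewrite ler_wpM2l ?ler0c ?dsum_norm_fst.
have le2 (L : hilbertType R) (A : bop H2 L) M : 0 <= M ->
    (forall y, `|A y| <= M%:C * `|y|) -> `|A x.2| <= M%:C * `|x|.
  by move=> M0 /(_ x.2) h; apply: le_trans h _; rewrite ler_wpM2l ?ler0c ?dsum_norm_snd.
apply: le_trans (dsum_norm_le _) _; rewrite /= !rmorphD !mulrDl.
apply: lerD; apply: le_trans (ler_normD _ _) _; apply: lerD.
- exact: le1.
- exact: le2.
- exact: le1.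
- exact: le2.
Qed.

Definition block : bop (dsum H1 H2) (dsum K1 K2) := Bop block_linear block_bounded.

End Block.

(* Main.v *)
Require Import Defs.
From HB Require Import structures.
From mathcomp Require Import all_boot all_order all_algebra.
From mathcomp Require Import sesquilinear complex.
From mathcomp Require Import boolp classical_sets functions reals.
From mathcomp Require Import interval_inference topology normedtype.
From mathcomp Require Import ring lra.

Set Implicit Arguments.
Unset Strict Implicit.
Unset Printing Implicit Defensive.

Import Order.TTheory GRing.Theory Num.Theory.
Import numFieldNormedType.Exports.

Local Open Scope ring_scope.

(** The triangle inequality applied to [T = Re T + i Im T] reduces the bound to
    a single self-adjoint block operator with blocks [S11], [S12], [adj S12],
    [S22].  Its action on [x] is dominated, norm by norm, by the action of the
    real symmetric matrix [[a, c], [c, b]] with [a = opnorm S11],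
    [b = opnorm S22], [c = opnorm S12] on the vector [(|x.1|, |x.2|)]; the two
    off-diagonal entries can both be [c] since passing to the adjoint does not increase
    the operator norm ([opnorm_adj_le]).  That matrix has nonnegative entries,
    so its norm on the plane is its largest eigenvalue
    [1/2 * (a + b + sqrt ((a - b)^2 + 4 c^2))] ([sym2_norm_le]), and this is
    exactly the quantity in the statement ([opnorm_block_adj_le]). *)

Section VectorNorm.
Variables (R : realType) (H : hilbertType R).
Implicit Type x : H.

Lemma hnorm_scale (a : R[i]) x : hnorm (a *: x) = complex.Re `|a| * hnorm x.
Proof. by apply: (@complexI R); rewrite rmorphM /= -!hnormE normrZ. Qed.

Lemma hnorm_eq0 x : hnorm x = 0 -> x = 0.
Proof. by move=> x0; apply/eqP; rewrite -normr_eq0 hnormE x0. Qed.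

End VectorNorm.

Section OperatorNorm.
Variables (R : realType) (H K : hilbertType R).
Implicit Type S : bop H K.

Lemma hnorm_bound S : exists2 M : R, 0 <= M & forall x, hnorm (S x) <= M * hnorm x.
Proof.
have [M M0 SM] := bop_bound S; exists M => // x.
by rewrite -lecR rmorphM /= -!hnormE.
Qed.

Lemma opnorm_has_ubound S :
  has_ubound [set hnorm (S x) | x in [set x | hnorm x <= 1]]%classic.
Proof.
have [M M0 SM] := hnorm_bound S; exists M => _ [x /= x1 <-].
by apply: le_trans (SM x) _; rewrite -[leRHS]mulr1 ler_wpM2l.
Qed.

Lemma opnorm_ge_unit S x : hnorm x <= 1 -> hnorm (S x) <= opnorm S.
Proof. by move=> x1; apply: ub_le_sup; [exact: opnorm_has_ubound | exists x]. Qed.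

Lemma opnorm_ge0 S : 0 <= opnorm S.
Proof.
apply: le_trans (hnorm_ge0 (S 0)) (opnorm_ge_unit _ _).
by rewrite hnorm0 ler01.
Qed.

Lemma hnorm_le_opnorm S x : hnorm (S x) <= opnorm S * hnorm x.
Proof.
have [/hnorm_eq0 ->|xn0] := eqVneq (hnorm x) 0.
  by rewrite linear0 !hnorm0 mulr0.
have x_gt0 : 0 < hnorm x by rewrite lt_neqAle eq_sym xn0 hnorm_ge0.
(* [opnorm] is a supremum over the unit ball, so [x] is normalized first. *)
pose r := ((hnorm x)^-1)%:C%C.
have rE : complex.Re `|r| = (hnorm x)^-1.
  by rewrite ger0_norm // ler0c invr_ge0 ltW.
rewrite -ler_pdivrMr // mulrC -rE -hnorm_scale -linearZ /=.
by apply: opnorm_ge_unit; rewrite hnorm_scale rE mulVf.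
Qed.

Lemma opnorm_le S (M : R) :
  0 <= M -> (forall x, hnorm (S x) <= M * hnorm x) -> opnorm S <= M.
Proof.
move=> M0 SM; apply: ge_sup.
  by exists (hnorm (S 0)), 0 => //=; rewrite hnorm0 ler01.
move=> _ [x /= x1 <-]; apply: le_trans (SM x) _.
by rewrite -[leRHS]mulr1 ler_wpM2l.
Qed.

End OperatorNorm.

(** The estimate [|S* y|^2 = <S (S* y), y> <= opnorm S * |S* y| * |y|], divided
    by [|S* y|]. *)
Lemma opnorm_adj_le (R : realType) (H K : hilbertType R) (S : bop H K) :
  opnorm (adj S) <= opnorm S.
Proof.
apply: opnorm_le => [|y]; first exact: opnorm_ge0.
have [->|zn0] := eqVneq (hnorm (adj S y)) 0.
  by rewrite mulr_ge0 ?opnorm_ge0 ?hnorm_ge0.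
have z_gt0 : 0 < hnorm (adj S y) by rewrite lt_neqAle eq_sym zn0 hnorm_ge0.
rewrite -(ler_pM2l z_gt0).
apply: (@le_trans _ _ (hnorm (S (adj S y)) * hnorm y)); last first.
  by rewrite mulrCA mulrA ler_wpM2r ?hnorm_ge0 ?hnorm_le_opnorm.
rewrite -lecR !rmorphM /= -!hnormE -expr2 normrE_dotp -adjP.
apply: le_trans (dotp_le _ _).
by rewrite ger0_norm // adjP dnorm_ge0.
Qed.

Section Sym2.
Variable R : realType.
Implicit Types a b c p q : R.

(** The largest eigenvalue of the matrix [[a, c], [c, b]]. *)
Definition sym2_eigen a b c : R :=
  1 / 2 * (a + b + Num.sqrt ((a - b) ^+ 2 + 4 * c ^+ 2)).

Section Eigen.
Variables a b c : R.
Let s := Num.sqrt ((a - b) ^+ 2 + 4 * c ^+ 2).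

Let s_sqr : s ^+ 2 = (a - b) ^+ 2 + 4 * c ^+ 2.
Proof.
rewrite sqr_sqrtr //; apply: addr_ge0; first exact: sqr_ge0.
by apply: mulr_ge0; [exact: ler0n | exact: sqr_ge0].
Qed.

(** The characteristic equation, in the factored form that lets [c] be split as
    the product of the square roots of [l - a] and [l - b]. *)
Lemma sym2_eigen_char :
  (sym2_eigen a b c - a) * (sym2_eigen a b c - b) = c ^+ 2.
Proof.
rewrite /sym2_eigen -/s.
transitivity (1 / 4 * (s ^+ 2 - (a - b) ^+ 2)); first by field.
by rewrite s_sqr; field.
Qed.

Let abs_le_s : `|a - b| <= s.
Proof.
rewrite -sqrtr_sqr ler_wsqrtr // lerDl.
by apply: mulr_ge0; [exact: ler0n | exact: sqr_ge0].
Qed.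

Lemma sym2_eigen_gel : a <= sym2_eigen a b c.
Proof. by move: abs_le_s; rewrite /sym2_eigen -/s ler_norml; lra. Qed.

Lemma sym2_eigen_ger : b <= sym2_eigen a b c.
Proof. by move: abs_le_s; rewrite /sym2_eigen -/s ler_norml; lra. Qed.

End Eigen.

(** With [M = [[a, c], [c, b]]] and [l] its largest eigenvalue, the
    Cayley-Hamilton identity turns [l^2 - M^2] into [(a + b) (l - M)], and
    [l - M] has the entries [u^2], [- u v], [v^2] of a rank one square. *)
Lemma sym2_norm_le a b c p q : 0 <= a -> 0 <= b -> 0 <= c ->
  (a * p + c * q) ^+ 2 + (c * p + b * q) ^+ 2 <=
    sym2_eigen a b c ^+ 2 * (p ^+ 2 + q ^+ 2).
Proof.
move=> a0 b0 c0; have la := sym2_eigen_gel a b c.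
have lb := sym2_eigen_ger a b c; have lc := sym2_eigen_char a b c.
move: (sym2_eigen a b c) la lb lc => l la lb lc.
pose u := Num.sqrt (l - a); pose v := Num.sqrt (l - b).
have uE : u ^+ 2 = l - a by rewrite sqr_sqrtr ?subr_ge0.
have vE : v ^+ 2 = l - b by rewrite sqr_sqrtr ?subr_ge0.
have cE : c = u * v.
  have uv0 : 0 <= u * v by rewrite mulr_ge0 ?sqrtr_ge0.
  by apply/eqP; rewrite -(eqrXn2 (ltn0Sn 1) c0 uv0) exprMn uE vE lc.
have aE : a = l - u ^+ 2 by rewrite uE; ring.
have bE : b = l - v ^+ 2 by rewrite vE; ring.
rewrite -subr_ge0.
have -> : l ^+ 2 * (p ^+ 2 + q ^+ 2)
    - ((a * p + c * q) ^+ 2 + (c * p + b * q) ^+ 2)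
    = (a + b) * (u * p - v * q) ^+ 2.
  by rewrite cE aE bE; ring.
by rewrite mulr_ge0 ?addr_ge0 ?sqr_ge0.
Qed.

End Sym2.

Section BlockNorm.
Variable R : realType.

Lemma dsum_hnorm_sqr (H K : hilbertType R) (x : dsum H K) :
  hnorm x ^+ 2 = hnorm x.1 ^+ 2 + hnorm x.2 ^+ 2.
Proof.
apply: (@complexI R); rewrite rmorphD !rmorphXn /= -!hnormE.
exact: dsum_norm_sqr.
Qed.

Lemma opnorm_block_adj_le (H K : hilbertType R)
    (S11 : bop H H) (S12 : bop K H) (S22 : bop K K) :
  opnorm (block S11 S12 (adj S12) S22) <=
    sym2_eigen (opnorm S11) (opnorm S22) (opnorm S12).
Proof.
set a := opnorm S11; set b := opnorm S22; set c := opnorm S12.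
have a0 : 0 <= a := opnorm_ge0 _; have b0 : 0 <= b := opnorm_ge0 _.
have c0 : 0 <= c := opnorm_ge0 _.
have l0 : 0 <= sym2_eigen a b c := le_trans a0 (sym2_eigen_gel a b c).
apply: opnorm_le => // x.
have lx0 := mulr_ge0 l0 (hnorm_ge0 x).
rewrite -(ler_pXn2r (ltn0Sn 1) (hnorm_ge0 _) lx0) exprMn !dsum_hnorm_sqr /=.
apply: le_trans (sym2_norm_le (hnorm x.1) (hnorm x.2) a0 b0 c0).
have le_sqr (r t : R) : 0 <= r -> r <= t -> r ^+ 2 <= t ^+ 2.
  by move=> r0 rt; rewrite lerXn2r // nnegrE (le_trans r0).
apply: lerD; apply: le_sqr; rewrite ?hnorm_ge0 //.
  apply: le_trans (Defs.hnormD (S11 x.1) (S12 x.2)) (lerD _ _);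
    exact: hnorm_le_opnorm.
apply: le_trans (Defs.hnormD (adj S12 x.1) (S22 x.2)) (lerD _ _).
  apply: le_trans (hnorm_le_opnorm _ _) _.
  by rewrite ler_wpM2r ?hnorm_ge0 ?opnorm_adj_le.
exact: hnorm_le_opnorm.
Qed.

Lemma opnorm_cartesian_le (H : hilbertType R) (S : bop H H) :
  opnorm S <= opnorm (Re_op S) + opnorm (Im_op S).
Proof.
apply: opnorm_le => [|x]; first by rewrite addr_ge0 ?opnorm_ge0.
rewrite [in leLHS](cartesian_decomposition S) bop_addE bop_scaleE mulrDl.
apply: le_trans (Defs.hnormD _ _) (lerD _ _); first exact: hnorm_le_opnorm.
by rewrite hnorm_scale normCi mul1r hnorm_le_opnorm.
Qed.

End BlockNorm.

Theorem theorem3p1 (R : realType) (H : hilbertType R)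
    (T : bop (dsum H H) (dsum H H))
    (T11 T12 T21 T22 A11 A12 A22 B11 B12 B22 : bop H H)
    (hT : T = block T11 T12 T21 T22)
    (hA : Re_op T = block A11 A12 (adj A12) A22)
    (hB : Im_op T = block B11 B12 (adj B12) B22) :
  opnorm (block T11 T12 T21 T22) <=
    1 / 2 * (opnorm A11 + opnorm A22
             + Num.sqrt ((opnorm A11 - opnorm A22) ^+ 2 + 4 * opnorm A12 ^+ 2))
    + 1 / 2 * (opnorm B11 + opnorm B22
             + Num.sqrt ((opnorm B11 - opnorm B22) ^+ 2 + 4 * opnorm B12 ^+ 2)).
Proof.
rewrite -hT; apply: le_trans (opnorm_cartesian_le T) _.
by rewrite hA hB; apply: lerD; exact: opnorm_block_adj_le.
Qed.
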